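(* Let $\mu$ be a Borel measure on $\mathbb{R}$. The following two statements are equivalent: (M) For each $a\in[-\infty,\infty)$, there is $t > a$ such that $\mu_{\mathrm{sf}}((a,t)) <\infty$. (I) For any real-valued Borel function $y$ on $\mathbb{R}$ such that $\int_{(-\infty,t)} |y|\,\mathrm{d} \mu < \infty$ for all $t \in \mathbb{R}$ and $$y(t) \leq \int_{(-\infty,t)} y \,\mathrm{d} \mu \quad \text{for } \mu\text{-a.e. } t \in \mathbb{R},$$ we have $y \leq 0$ $\mu$-a.e. In this case (i.e. if these equivalent statements hold), $\mu_{\mathrm{sf}}$ is even $\sigma$-finite.
   Context: A Borel measure on $\mathbb{R}$ is any (countably additive) measure $\mu:\mathcal{B}(\mathbb{R})\to[0,\infty]$ on the Borel $\sigma$-algebra $\mathcal{B}(\mathbb{R})$ of $\mathbb{R}$ with its standard topology; no finiteness, local finiteness, $\sigma$-finiteness or semi-finiteness is assumed. The semi-finite part of $\mu$ is the measure $\mu_{\mathrm{sf}}:\mathcal{B}(\mathbb{R})\to[0,\infty]$ given by $\mu_{\mathrm{sf}}(E)=\sup\{\mu(E\cap F): F\in\mathcal{B}(\mathbb{R}),\ \mu(F)<\infty\}$. For $a=-\infty$, $(a,t)$ means $(-\infty,t)$. *)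

(* Defs.v *)
From HB Require Import structures.
From mathcomp Require Import all_boot all_order all_algebra.
From mathcomp Require Import all_classical all_reals all_analysis.

Set Implicit Arguments.
Unset Strict Implicit.
Unset Printing Implicit Defensive.

Import Order.TTheory GRing.Theory Num.Theory.
Import numFieldNormedType.Exports.

Local Open Scope classical_set_scope.
Local Open Scope ring_scope.
Local Open Scope ereal_scope.

Definition semifinite_part d (T : measurableType d) (R : realType)
    (mu : {measure set T -> \bar R}) (E : set T) : \bar R :=
  ereal_sup [set mu (E `&` F) | F in [set F | measurable F /\ mu F < +oo]].

(* Main.v *)
(* (M) => (I).  Put f = max(y, 0), so that f <= g a.e. with
   g(t) = \int_(]-oo, t[) f.  If f vanishes a.e. before a, then it vanishes
   a.e. at a as well.  Since {f > 0} is sigma-finite before any t, mu is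
   dominated there by its semi-finite part, so {f > 0} has measure at most 1/2
   in some ]a, t[, whence g(t) <= g(t)/2 and f vanishes a.e. before t.  One
   concludes by a supremum argument, which also yields sigma-finiteness, a
   singleton always having finite semi-finite part.

   (I) => (M).  If every ]a, t[ has infinite semi-finite part, there are
   s_0 >= s_1 >= ... > a and G_n included in [s_(n+1), s_n[ of finite measure at
   least 2.  Then y = 2^-(n+1) / mu(G_n) on G_n, and 0 elsewhere, is integrable
   and bounded at any t in G_n by the integral 2^-(n+2) of y over G_(n+1), which
   lies before t. *)
Require Import Defs.
From HB Require Import structures.
From mathcomp Require Import all_boot all_order all_algebra.
From mathcomp Require Import all_classical all_reals all_analysis.
From mathcomp Require Import measurable_realfun lra.

Set Implicit Arguments.
Unset Strict Implicit.
Unset Printing Implicit Defensive.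

Import Order.TTheory GRing.Theory Num.Theory.
Import numFieldNormedType.Exports.

Local Open Scope classical_set_scope.
Local Open Scope ring_scope.
Local Open Scope ereal_scope.

(** * Propagation along the real line *)

(* The supremum argument, for a sigma-ideal Q of sets; the case a = -oo of the
   last premise starts the induction. *)
Lemma ray_induction (R : realType) (Q : set (set R)) :
  Q set0 ->
  (forall A B : set R, A `<=` B -> Q B -> Q A) ->
  (forall F : (set R)^nat, (forall n, Q (F n)) -> Q (\bigcup_n F n)) ->
  (forall a : \bar R, a < +oo -> Q [set x | x%:E < a] ->
     exists t : R, a < t%:E /\ Q `]-oo, t[%classic) ->
  Q [set: R].
Proof.
move=> Q0 QS Qbig step.
pose c := ereal_sup [set t%:E | t in [set t : R | Q `]-oo, t[%classic]].
have Qc : Q [set x | x%:E < c].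
  (* The rays in [Q] with rational endpoint are countably many and already exhaust the points below
     [c]; the remaining codes give the empty set. *)
  pose F (n : nat) : set R :=
    if unpickle n is Some q then
      if pselect (Q `]-oo, (ratr q : R)[%classic) then `]-oo, (ratr q : R)[%classic
      else set0
    else set0.
  apply: (QS _ (\bigcup_n F n)); last first.
    apply: Qbig => n; rewrite /F; case: unpickle => // q.
    by case: pselect.
  move=> x /= /ereal_sup_gt[_ [t Qt <-]]; rewrite lte_fin => /rat_in_itvoo[q].
  rewrite in_itv /= => /andP[xq qt]; exists (pickle q); first exact: I.
  rewrite /F pickleK; case: pselect => [Qq|nQ]; first by rewrite /= in_itv.
  have [] := nQ; move: Qt; apply: QS => z /=; rewrite !in_itv /= => zq.
  exact: lt_trans qt.
(* If [c < +oo], the last premise gives a ray in [Q] ending beyond [c], which is absurd. *)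
have := leey c; rewrite le_eqVlt => /orP[/eqP cy|/step /(_ Qc)[t [ct Qt]]].
  by apply: QS Qc => x _ /=; rewrite cy ltry.
have : t%:E <= c by apply: ereal_sup_ubound; exists t.
by rewrite leNgt ct.
Qed.

(** A countable family approaching [a] from above, also for [a = -oo], so that continuity of
    measures along sequences applies near [a]. *)
Lemma exists_decr_seq (R : realType) (a : \bar R) : a < +oo ->
  exists u : R^nat, [/\ {homo u : m n / (m <= n)%N >-> (n <= m)%R},
    forall n, a < (u n)%:E &
    forall x : R, a < x%:E -> exists n, (u n <= x)%R].
Proof.
case: a => [r _| //|_]; last first.
  exists (fun n => - n%:R)%R; split => [m n mn|n|x _].
  - by rewrite lerN2 ler_nat.
  - by rewrite ltNyr.
  - exists (Num.truncn (`|x|)%R).+1; rewrite lerNl (le_trans _ (ltW (truncnS_gt _)))//.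
    by rewrite (le_trans (ler_norm _))// normrN.
exists (fun n => r + n.+1%:R^-1)%R; split => [m n mn|n|x].
- by rewrite lerD2l lef_pV2 ?posrE ?ltr0n// ler_nat.
- by rewrite lte_fin ltrDl invr_gt0 ltr0n.
- rewrite lte_fin -subr_gt0 => rx.
  exists (Num.truncn (x - r)^-1)%R; rewrite -lerBrDl.
  by rewrite invf_ple ?posrE ?ltr0n// ltW// truncnS_gt.
Qed.

(** * Measurable intervals and small measure near an endpoint *)

Lemma measurable_gt_ereal (R : realType) (a : \bar R) :
  measurable [set x : measurableTypeR R | a < x%:E].
Proof.
rewrite -[X in measurable X]setTI.
by apply: emeasurable_fun_o_infty => //; exact/measurable_EFinP.
Qed.

Lemma measurable_lt_ereal (R : realType) (a : \bar R) :
  measurable [set x : measurableTypeR R | x%:E < a].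
Proof.
rewrite -[X in measurable X]setTI.
by apply: emeasurable_fun_infty_o => //; exact/measurable_EFinP.
Qed.

Lemma measurable_gtlt_ereal (R : realType) (a b : \bar R) :
  measurable [set x : measurableTypeR R | a < x%:E < b].
Proof.
rewrite [X in measurable X](_ : _ = [set x | a < x%:E] `&` [set x | x%:E < b]).
  by apply: measurableI; [exact: measurable_gt_ereal|exact: measurable_lt_ereal].
by apply/seteqP; split => x /=; [move=> /andP|move=> [-> ->]].
Qed.

(** Continuity from above: every point of [D] lies above [a], so the traces of [D] on the rays
    []-oo, u n[] decrease to the empty set, and [D] has finite measure. *)
Lemma measure_small_tail (R : realType)
    (mu : {measure set (measurableTypeR R) -> \bar R}) (a e : \bar R)
    (D : set (measurableTypeR R)) :
  a < +oo -> 0 < e -> measurable D -> mu D < +oo ->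
  (forall x, D x -> a < x%:E) ->
  exists s : R, a < s%:E /\ mu (D `&` `]-oo, s[%classic) < e.
Proof.
move=> ay e0 mD Doo aD; have [u [u_decr au ua]] := exists_decr_seq ay.
pose F n := D `&` `]-oo, u n[%classic.
have mF n : measurable (F n) by apply: measurableI => //; exact: measurable_itv.
have F0 : \bigcap_n F n = set0.
  apply/seteqP; split => // x Fx; have [Dx _] := Fx 0%N I.
  have [n unx] := ua _ (aD _ Dx); have [_ /=] := Fx n I.
  by rewrite in_itv /= ltNge unx.
have := @nonincreasing_cvg_mu _ _ _ mu F; rewrite F0 measure0.
move=> /(_ _ mF measurable0 _ [set x | x < e]) [].
- rewrite (le_lt_trans _ Doo)// le_measure ?inE//; exact: subIsetl.
- move=> m n mn; apply/subsetPset => x [Dx]; rewrite /= in_itv /= => xu.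
  by split => //=; rewrite in_itv /= (lt_le_trans xu)// u_decr.
- by apply: open_nbhs_nbhs; split => //; exact: open_ereal_lt_ereal.
- by move=> n _ /(_ n (leqnn _)) /= Fne; exists (u n).
Qed.

(** * The semi-finite part *)

Lemma semifinite_part_le (R : realType) d (T : measurableType d)
    (mu : {measure set T -> \bar R}) (E F : set T) :
  measurable F -> mu F < +oo -> mu (E `&` F) <= semifinite_part mu E.
Proof. by move=> mF Foo; apply: ereal_sup_ubound; exists F. Qed.

(** Each [F n] competes in the supremum, and continuity from below carries the bound to the
    union. *)
Lemma measure_le_semifinite_part (R : realType) d (T : measurableType d)
    (mu : {measure set T -> \bar R}) (E : set T) (F : (set T)^nat) :
  measurable E -> (forall n, measurable (F n)) -> (forall n, mu (F n) < +oo) ->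
  {homo F : m n / (m <= n)%N >-> m `<=` n} ->
  mu (E `&` \bigcup_n F n) <= semifinite_part mu E.
Proof.
move=> mE mF Foo Fnd; rewrite setI_bigcupr.
have mEF n : measurable (E `&` F n) by exact: measurableI.
have cF : mu (E `&` F n) @[n --> \oo] --> mu (\bigcup_n (E `&` F n)).
  apply: nondecreasing_cvg_mu => //; first exact: bigcup_measurable.
  by move=> m n mn; apply/subsetPset; apply: setIS; exact: Fnd.
rewrite -(cvg_lim _ cF)//; apply: lime_le; first by apply/cvg_ex; eexists; exact: cF.
by apply: nearW => n; exact: semifinite_part_le.
Qed.

(** Takes care of the endpoint [a], which is missing between []-oo, a[] and []a, t[], whatever its
    mass. *)
Lemma semifinite_part_singleton (R : realType)
    (mu : {measure set (measurableTypeR R) -> \bar R}) (a : R) :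
  semifinite_part mu [set a] < +oo.
Proof.
have [aoo|] := ltP (mu [set a]) +oo.
  apply: le_lt_trans aoo; apply: ge_ereal_sup => _ [F [mF _] <-].
  by rewrite le_measure ?inE//; exact: measurableI.
rewrite leye_eq => /eqP aoo.
apply: (@le_lt_trans _ _ 0) => //; apply: ge_ereal_sup => _ [F [mF Foo] <-].
(* A set of finite measure cannot contain an atom of infinite measure. *)
rewrite (_ : _ `&` _ = set0) ?measure0//.
apply/seteqP; split => // x [-> Fa].
have : mu [set a] <= mu F by rewrite le_measure ?inE// => y ->.
by rewrite aoo leye_eq => /eqP Fy; move: Foo; rewrite Fy.
Qed.

Lemma semifinite_part0 (R : realType) d (T : measurableType d)
    (mu : {measure set T -> \bar R}) : semifinite_part mu set0 < +oo.
Proof.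
apply: (@le_lt_trans _ _ 0) => //; apply: ge_ereal_sup => _ [F _ <-].
by rewrite set0I measure0.
Qed.

(** The sets covered by countably many measurable sets of finite semi-finite part form a
    sigma-ideal, to which [ray_induction] applies. *)
Lemma semifinite_part_sigma_finite (R : realType)
    (mu : {measure set (measurableTypeR R) -> \bar R}) :
  (forall a : \bar R, a < +oo -> exists t : R, a < t%:E /\
     semifinite_part mu [set x : R | a < x%:E < t%:E] < +oo) ->
  sigma_finite [set: measurableTypeR R] (semifinite_part mu).
Proof.
move=> M.
pose fin (E : set (measurableTypeR R)) :=
  measurable E /\ semifinite_part mu E < +oo.
have fin0 : fin set0 by split => //; exact: semifinite_part0.
suff [F [finF TF]] : exists F : (set (measurableTypeR R))^nat,
    (forall n, fin (F n)) /\ [set: R] `<=` \bigcup_n F n.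
  by exists F => //; apply/seteqP; split.
apply: (@ray_induction R (fun A : set R =>
    exists F : (set (measurableTypeR R))^nat,
      (forall n, fin (F n)) /\ A `<=` \bigcup_n F n)).
- by exists (fun=> set0); split.
- by move=> A B AB [F [finF BF]]; exists F; split => //; exact: subset_trans BF.
- move=> A /choice[F /all_and2[finF AF]].
  (* A sequence of covers is flattened through the codes of pairs; the remaining codes give the
     empty set. *)
  exists (fun k => if unpickle k is Some (n, m) then F n m else set0); split.
    by move=> k; case: unpickle => [[n m]|].
  move=> x [n _ /AF[m _ Fx]]; exists (pickle (n, m)); first exact: I.
  by rewrite pickleK.
- move=> a ay [F [finF aF]]; have [t [at_ tfin]] := M _ ay.
  exists t; split => //.
  (* The ray before [t] splits at [a] into the interval given by (M), the point [a] (no point if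
     [a = -oo]) and the part already covered. *)
  exists (fun k => match k with
    | 0%N => [set x : R | a < x%:E < t%:E]
    | 1%N => [set x : R | x%:E = a]
    | k.+2 => F k end); split.
    move=> [|[|k]]; last exact: finF.
      by split => //; exact: measurable_gtlt_ereal.
    case: a {ay at_ tfin aF} => [a||].
    + rewrite (_ : [set x | _] = [set a]).
        by split => //; exact: semifinite_part_singleton.
      by apply/seteqP; split => x /=; [move=> [->]|move=> ->].
    + by rewrite (_ : [set x | _] = set0)//; apply/seteqP; split => x.
    + by rewrite (_ : [set x | _] = set0)//; apply/seteqP; split => x.
  move=> x /=; rewrite in_itv /= => xt.
  have [xa|ax|xa] := ltgtP x%:E a.
  + by have [k _ Fx] := aF _ xa; exists k.+2.
  + by exists 0%N => //=; rewrite ax lte_fin.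
  + by exists 1%N.
Qed.

(** * From (M) to (I): extending a ray on which [f] vanishes *)

Lemma integral_eq0_negligible (R : realType) d (T : measurableType d)
    (mu : {measure set T -> \bar R}) (f : T -> R) (D : set T) :
  measurable D -> measurable_fun D f -> (forall x, 0 <= f x)%R ->
  \int[mu]_(x in D) (f x)%:E = 0 <->
    mu.-negligible ([set x | 0 < f x]%R `&` D).
Proof.
move=> mD mf f0.
have -> : \int[mu]_(x in D) (f x)%:E = \int[mu]_(x in D) `|(EFin \o f) x|.
  by apply: eq_integral => x _; rewrite gee0_abs// lee_fin.
rewrite ae_eq_integral_abs//; last exact/measurable_EFinP.
rewrite /ae_eq /= /prop_near1 /nbhs /=.
rewrite /almost_everywhere (_ : ~` _ = [set x | 0 < f x]%R `&` D)//.
apply/seteqP; split => x /=.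
  move=> /not_implyP[Dx fx]; split => //; rewrite lt_neqAle f0 andbT eq_sym.
  by apply/eqP => fx0; apply: fx; rewrite fx0.
by move=> [fx Dx] /(_ Dx)[fx0]; move: fx; rewrite fx0 ltxx.
Qed.

(** The induction step: once [f > 0] only on a set of measure at most 1/2 before [t'], up to a null
    set, integrating [f <= g] over it bounds [g t'] by its own half. *)
Lemma null_extension (R : realType)
    (mu : {measure set (measurableTypeR R) -> \bar R})
    (f : measurableTypeR R -> R) (a : \bar R) (t : R) :
  measurable_fun [set: measurableTypeR R] f -> (forall x, 0 <= f x)%R ->
  (forall t : R, \int[mu]_(s in `]-oo, t[) (f s)%:E < +oo) ->
  {ae mu, forall t, (f t)%:E <= \int[mu]_(s in `]-oo, t[) (f s)%:E} ->
  a < t%:E -> semifinite_part mu [set x : R | a < x%:E < t%:E] < +oo ->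
  mu.-negligible ([set x | 0 < f x]%R `&` [set x : R | x%:E < a]) ->
  exists t' : R, a < t'%:E /\
    mu.-negligible ([set x | 0 < f x]%R `&` `]-oo, t'[%classic).
Proof.
move=> mf f0 foo fle at_ tfin Pa; set P := [set x | _].
have mfE D : measurable_fun D (EFin \o f).
  by apply/measurable_EFinP; exact: measurable_funTS.
have f0E x : 0 <= (f x)%:E by rewrite lee_fin.
have mP : measurable (P : set (measurableTypeR R)).
  rewrite -[P]setTI (_ : P = [set x | 0 < (f x)%:E]).
    exact: (emeasurable_fun_o_infty measurableT (mfE _)).
  by apply/seteqP; split => x /=; rewrite lte_fin.
have mitv (s : R) : measurable (`]-oo, s[%classic : set (measurableTypeR R)).
  exact: measurable_itv.
(* The [F n] increase to cover the set where [f > 0] before [t], and Markov's inequality gives them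
   finite measure. *)
pose F (n : nat) : set (measurableTypeR R) :=
  `]-oo, t[ `&` [set x | n.+1%:R^-1%:E <= `|(f x)%:E|].
have mF n : measurable (F n).
  apply: (emeasurable_fun_c_infty (mitv t)).
  by apply: measurableT_comp => //; exact: mfE.
have Foo n : mu (F n) < +oo.
  have n0 : (0 < n.+1%:R^-1 :> R)%R by rewrite invr_gt0.
  have := le_integral_abse mu (mitv t) (mfE _) n0.
  rewrite (_ : \int[mu]_(x in _) _ = \int[mu]_(x in `]-oo, t[) (f x)%:E); last first.
    by apply: eq_integral => x _ /=; rewrite ger0_norm.
  move=> /le_lt_trans/(_ (foo t)); rewrite -/(F n).
  case: (mu (F n)) (measure_ge0 mu (F n)) => [r _ _|_|//].
    exact: ltry.
  by rewrite gt0_muley ?lte_fin.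
have Fnd : {homo F : m n / (m <= n)%N >-> m `<=` n}.
  move=> m n mn x [xt] /= mx; split => //=; apply: le_trans mx.
  by rewrite lee_fin lef_pV2 ?posrE ?ltr0n// ler_nat.
(* Being covered by the [F n], [D] has measure at most the semi-finite part of []a, t[], hence
   finite. *)
pose D : set (measurableTypeR R) := P `&` [set x | a < x%:E < t%:E].
have mD : measurable D by apply: measurableI => //; exact: measurable_gtlt_ereal.
have DF : D `<=` [set x : R | a < x%:E < t%:E] `&` \bigcup_n F n.
  move=> x [Px atx]; split => //; have /andP[_ xt] := atx.
  have [n _ /(_ n (leqnn _)) nfx] := @near_infty_natSinv_lt R (PosNum Px).
  exists n => //; split; first by rewrite /= in_itv.
  by rewrite /= lee_fin (le_trans (ltW nfx))// ler_norm.
have Doo : mu D < +oo.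
  apply: le_lt_trans tfin.
  have := measure_le_semifinite_part (measurable_gtlt_ereal a t%:E) mF Foo Fnd.
  apply: le_trans; rewrite le_measure ?inE//.
  apply: measurableI; [exact: measurable_gtlt_ereal|exact: bigcup_measurable].
have half0 : 0 < (2^-1 : R)%:E by rewrite lte_fin.
have ay : a < +oo by exact: lt_trans at_ (ltry _).
have aD x : D x -> a < x%:E by move=> [_ /andP[]].
have [s [as_ Ds]] := measure_small_tail ay half0 mD Doo aD.
(* With the minimum, []a, t'[] lies in []a, t[] and also before [s], where [D] has measure below
   1/2. *)
pose t' := Num.min t s; exists t'.
have at' : a < t'%:E by rewrite /t' /Num.min; case: ifP.
split => //.
pose E : set (measurableTypeR R) := P `&` [set x | a < x%:E < t'%:E].
have mE : measurable E by apply: measurableI => //; exact: measurable_gtlt_ereal.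
have muE : mu E <= (2^-1)%:E.
  apply: le_trans (ltW Ds); rewrite le_measure ?inE//; first exact: measurableI.
  move=> x [Px /andP[ax]]; rewrite /t' lte_fin lt_min => /andP[xt xs].
  by split; [split => //=; rewrite ax lte_fin|rewrite /= in_itv].
pose g (r : R) := \int[mu]_(s in `]-oo, r[) (f s)%:E.
have g0 r : 0 <= g r by exact: integral_ge0.
have gmono r1 r2 : (r1 <= r2)%R -> g r1 <= g r2.
  move=> r12; apply: (ge0_subset_integral _ (mitv _) (mitv _) (mfE _)).
    by move=> x _; exact: f0E.
  by move=> x /=; rewrite !in_itv /= => xr1; exact: lt_le_trans r12.
have [N [mN N0 fN]] := fle.
(* If [f] is positive at the point [a], then [a] lies in the exceptional set [N], because
   [g a = 0]. *)
have [Z [mZ Z0 PZ]] : mu.-negligible (P `&` [set x : R | x%:E <= a]).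
  apply: negligibleS (negligibleU Pa (ex_intro _ N (And3 mN N0 (@subset_refl _ N)))).
  move=> x [Px] /=; rewrite le_eqVlt => /orP[/eqP xa|xa]; [right|by left].
  apply: fN => /=; suff -> : \int[mu]_(s in `]-oo, x[) (f s)%:E = 0.
    by apply/negP; rewrite -ltNge lte_fin.
  apply/integral_eq0_negligible => //; first exact: measurable_funTS.
  apply: negligibleS Pa => z [Pz]; rewrite /= in_itv /= => zx; split => //=.
  by rewrite -xa lte_fin.
have PZE : P `&` `]-oo, t'[%classic `<=` Z `|` E.
  move=> x [Px]; rewrite /= in_itv /= => xt'.
  have [xa|ax] := leP x%:E a; first by left; apply: PZ.
  by right; split => //=; rewrite ax lte_fin.
(* Before [t'] and outside the null set [Z], [f] is positive only on [E]; there [f <= g <= g t']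
   almost everywhere. *)
have gE : g t' <= g t' * mu E.
  have -> : g t' * mu E = \int[mu]_(x in E) cst (g t') x by rewrite integral_cst.
  have {1}-> : g t' = \int[mu]_(x in E) (f x)%:E.
    rewrite /g (ge0_negligible_integral mZ (mitv _) (mfE _) (fun x _ => f0E x) Z0).
    rewrite [RHS](ge0_negligible_integral mZ mE (mfE _) (fun x _ => f0E x) Z0).
    rewrite integral_mkcond [RHS]integral_mkcond; apply: eq_integral => x _.
    rewrite /patch; case: ifPn => [|xt']; case: ifPn => [|xE]//.
      rewrite in_setE => -[xt' nZ]; congr EFin; apply/eqP; rewrite eq_le f0 andbT.
      rewrite leNgt; apply/negP => Px; move/negP: xE; apply.
      by rewrite in_setE; split => //; have [] := PZE x (conj Px xt').
    rewrite in_setE => -[[_ /andP[_ xt]] nZ]; move/negP: xt'; case.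
    by rewrite in_setE; split => //=; rewrite in_itv.
  apply: (@ae_ge0_le_integral _ _ _ mu E mE (EFin \o f) (cst (g t'))) => //.
  - by move=> x _; exact: f0E.
  - by move=> x _; exact: g0.
  exists N; split => // x /= /not_implyP[[Px /andP[_ xt']] nle]; apply: fN => /=.
  apply: contra_not nle => /le_trans; apply; apply: gmono.
  by rewrite -lee_fin ltW.
have gt'0 : g t' = 0.
  have gfin : g t' \is a fin_num by rewrite ge0_fin_numE// foo.
  apply/eqP; rewrite eq_le g0 andbT.
  have := le_trans gE (lee_wpmul2l (g0 t') muE).
  rewrite -(fineK gfin) -EFinM !lee_fin => ?; lra.
by apply/integral_eq0_negligible => //; exact: measurable_funTS.
Qed.

(** * From (I) to (M): building the counterexample *)

(** A set of finite measure above 3 loses measure less than 1 when cut near [a]; at least 2 remains,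
    at or above some [s' > a], which leaves room below for the next piece. *)
Lemma infinite_semifinite_piece (R : realType)
    (mu : {measure set (measurableTypeR R) -> \bar R}) (a : \bar R) (s : R) :
  a < s%:E -> ~ semifinite_part mu [set x : R | a < x%:E < s%:E] < +oo ->
  exists (G : set (measurableTypeR R)) (s' : R),
    [/\ a < s'%:E, (s' <= s)%R, measurable G, 2%:E <= mu G < +oo &
        G `<=` `[s', s[%classic].
Proof.
move=> as_ sfoo.
have /ereal_sup_gt[_ [F [mF Foo] <-] muF] :
    3%:E < semifinite_part mu [set x : R | a < x%:E < s%:E].
  by move/negP: sfoo; rewrite -leNgt leye_eq => /eqP ->; exact: ltry.
set D : set (measurableTypeR R) := _ `&` F in muF.
have mD : measurable D by apply: measurableI => //; exact: measurable_gtlt_ereal.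
have Doo : mu D < +oo.
  by apply: le_lt_trans Foo; rewrite le_measure ?inE// => x [].
have aD x : D x -> a < x%:E by case=> /andP[].
have ay : a < +oo by exact: lt_trans as_ (ltry _).
have [r [ar Dr]] := measure_small_tail ay lte01 mD Doo aD.
pose s' := Num.min r s; pose U : set (measurableTypeR R) := `]-oo, s'[%classic.
have mU : measurable U by exact: measurable_itv.
exists (D `\` U), s'; split.
- by rewrite /s' /Num.min; case: ifP.
- by rewrite /s' ge_min lexx orbT.
- exact: measurableD.
- apply/andP; split; last first.
    by apply: le_lt_trans Doo; rewrite le_measure ?inE//; exact: measurableD.
  rewrite leNgt; apply/negP => DU2; move: muF; apply/negP; rewrite -leNgt.
  rewrite (measureDI mu mD mU) (_ : 3%:E = 2%:E + 1); last first.
    by rewrite -EFinD; congr EFin; lra.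
  apply: leeD; first exact: ltW.
  apply: le_trans (ltW Dr); rewrite le_measure ?inE//.
  + exact: measurableI.
  + by apply: measurableI => //; exact: measurable_itv.
  + move=> x [Dx]; rewrite /U /= in_itv /= lt_min => /andP[xr _].
    by split => //=; rewrite in_itv.
- move=> x [[/andP[_ xs] _]]; rewrite /U /= !in_itv /= => /negP.
  by rewrite -leNgt => ->; rewrite -lte_fin.
Qed.

Lemma exists_step_function (R : realType) d (T : measurableType d)
    (G : (set T)^nat) (c : R^nat) :
  (forall n, measurable (G n)) -> trivIset setT G ->
  exists y : T -> R, [/\ measurable_fun setT y,
    forall n x, G n x -> y x = c n &
    forall x, ~ (\bigcup_n G n) x -> y x = 0%R].
Proof.
(* [xget] picks an index whose set contains [x], the only one by disjointness; its default 0 is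
   masked later by restricting [h] to the union. *)
move=> mG tG; pose h x := c (xget 0%N [set n | G n x]).
have hE n x : G n x -> h x = c n.
  move=> Gnx; rewrite /h; case: xgetP => [m _ Gmx|/(_ n)]//.
  by congr c; apply: tG => //; exists x.
exists (h \_ (\bigcup_n G n)); split.
- have mUG : measurable (\bigcup_n G n) by exact: bigcupT_measurable.
  apply/(measurable_restrictT h mUG).
  apply/measurable_fun_bigcup => // n.
  by apply: (eq_measurable_fun (cst (c n))) => // x; rewrite in_setE => /hE.
- move=> n x Gnx; rewrite patchT; first exact: hE.
  by rewrite in_setE; exists n.
- by move=> x nGx; rewrite patchN//; apply/negP; rewrite in_setE.
Qed.

(** * The equivalence and sigma-finiteness *)

Theorem theorem2p5 (R : realType)
    (mu : {measure set (measurableTypeR R) -> \bar R}) :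
  let M :=
    forall a : \bar R, a < +oo ->
      exists t : R, a < t%:E /\
        semifinite_part mu [set x : R | a < x%:E < t%:E] < +oo in
  let I :=
    forall y : measurableTypeR R -> R, measurable_fun [set: measurableTypeR R] y ->
      (forall t : R, \int[mu]_(s in `]-oo, t[) `|(y s)%:E| < +oo) ->
      {ae mu, forall t, (y t)%:E <= \int[mu]_(s in `]-oo, t[) (y s)%:E} ->
      {ae mu, forall t, (y t <= 0)%R} in
  (M <-> I) /\ (M -> sigma_finite [set: measurableTypeR R] (semifinite_part mu)).
Proof.
have mitv (s : R) : measurable (`]-oo, s[%classic : set (measurableTypeR R)).
  exact: measurable_itv.
move=> M I; split; last exact: semifinite_part_sigma_finite.
split=> [HM y my yoo yle|HI a ay].
- pose f x := Num.max (y x) 0%R.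
  have f0 x : (0 <= f x)%R by rewrite /f le_max lexx orbT.
  have yf x : (y x <= f x)%R by rewrite /f le_max lexx.
  have fy x : (f x <= `|y x|)%R by rewrite /f ge_max ler_norm normr_ge0.
  have mf : measurable_fun [set: measurableTypeR R] f by exact: measurable_maxr.
  have mE (h : measurableTypeR R -> R) D :
      measurable_fun [set: measurableTypeR R] h -> measurable_fun D (EFin \o h).
    by move=> mh; apply/measurable_EFinP; exact: measurable_funTS.
  have foo t : \int[mu]_(s in `]-oo, t[) (f s)%:E < +oo.
    apply: le_lt_trans (yoo t); apply: ge0_le_integral => //.
    + by move=> x _; rewrite lee_fin.
    + exact: mE.
    + by apply: measurableT_comp => //; exact: mE.
    + by move=> x _; rewrite lee_fin.
  have iy t : mu.-integrable `]-oo, t[ (EFin \o y).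
    by apply/integrableP; split; [exact: mE|exact: yoo].
  have if_ t : mu.-integrable `]-oo, t[ (EFin \o f).
    apply/integrableP; split; first exact: mE.
    rewrite (_ : \int[mu]_(x in _) _ = \int[mu]_(s in `]-oo, t[) (f s)%:E)//.
    by apply: eq_integral => x _ /=; rewrite ger0_norm.
  (* Where [y < 0], [f] is 0 and the integral is nonnegative; elsewhere [f = y], and [y <= f] passes
     to the integrals. *)
  have fle : {ae mu, forall t, (f t)%:E <= \int[mu]_(s in `]-oo, t[) (f s)%:E}.
    apply: filterS yle => t yt; rewrite {1}/f /Num.max; case: ifPn => _.
      by apply: integral_ge0 => x _; rewrite lee_fin.
    apply: le_trans yt _; apply: le_integral => // x _.
    by rewrite lee_fin.
  suff : mu.-negligible ([set x | 0 < f x]%R `&` setT).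
    apply: negligibleS => x /= /negP; rewrite -ltNge => yx.
    by split => //=; exact: lt_le_trans (yf x).
  apply: (@ray_induction R (fun A => mu.-negligible ([set x | 0 < f x]%R `&` A))).
  + by rewrite setI0; exact: negligible_set0.
  + by move=> A B AB; apply: negligibleS; exact: setIS.
  + by move=> F F0; rewrite setI_bigcupr; exact: negligible_bigcup.
  + move=> a ay Pa; have [t [at_ tfin]] := HM _ ay.
    exact: null_extension at_ tfin Pa.
- apply: contrapT => /forallNP nM.
  (* Choice requires a total function, sending [s] to a piece and its lower endpoint; at points not
     above [a] the value is a placeholder. *)
  have /choice[h hP] : forall s : R, exists p : set (measurableTypeR R) * R,
      a < s%:E -> [/\ a < p.2%:E, (p.2 <= s)%R, measurable p.1,
        2%:E <= mu p.1 < +oo & p.1 `<=` `[p.2, s[%classic].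
    move=> s; have [as_|_] := ltP a s%:E; last by exists (set0, 0%R).
    have [||G [s' Gs']] := @infinite_semifinite_piece _ mu a s => //.
      by move=> sfin; apply: (nM s).
    by exists (G, s').
  have [u [_ au _]] := exists_decr_seq ay.
  (* Each lower endpoint bounds the next piece from above, so every piece lies before all points of
     the previous one. *)
  pose s n := iter n (fun r => (h r).2) (u 0%N).
  have as_ n : a < (s n)%:E by elim: n => [|n IH]; [exact: au|case: (hP _ IH)].
  pose G n := (h (s n)).1.
  have sle n : (s n.+1 <= s n)%R by case: (hP _ (as_ n)).
  have mG n : measurable (G n) by case: (hP _ (as_ n)).
  have G2 n : 2%:E <= mu (G n) by case: (hP _ (as_ n)) => _ _ _ /andP[].
  have Goo n : mu (G n) < +oo by case: (hP _ (as_ n)) => _ _ _ /andP[].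
  have Gs n : G n `<=` `[s n.+1, s n[%classic by case: (hP _ (as_ n)).
  have sdecr m n : (m <= n)%N -> (s n <= s m)%R.
    move=> /subnK <-; elim: (n - m)%N => [//|k IH]; rewrite addSn.
    exact: le_trans (sle _) IH.
  have tG : trivIset setT G.
    have Glt m n x : (m < n)%N -> G m x -> G n x -> False.
      move=> mn /Gs /=; rewrite in_itv /= => /andP[smx _] /Gs /=.
      rewrite in_itv /= => /andP[_]; apply/negP; rewrite -leNgt.
      exact: le_trans (sdecr _ _ mn) smx.
    move=> m n _ _ [x [Gm Gn]]; have [mn|nm|//] := ltngtP m n.
    + by have := Glt _ _ _ mn Gm Gn.
    + by have := Glt _ _ _ nm Gn Gm.
  have Gfin n : mu (G n) \is a fin_num by rewrite ge0_fin_numE.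
  have fG2 n : (2 <= fine (mu (G n)))%R by rewrite -lee_fin fineK.
  (* Normalised so that [y] has integral [2^-(n+1)] over [G n], in the shape that [epsilon_trick0]
     sums to at most 1. *)
  pose c n : R := (1 / (2 ^ n.+1)%:R / fine (mu (G n)))%R.
  have [y [my yG y0]] := exists_step_function c mG tG.
  have c0 n : (0 < c n)%R.
    by rewrite /c !divr_gt0// ?ltr0n ?expn_gt0// (lt_le_trans _ (fG2 n)).
  have yge0 x : (0 <= y x)%R.
    have [[n _ /yG ->]|/y0 ->//] := pselect ((\bigcup_n G n) x).
    exact/ltW/c0.
  have my' D : measurable_fun D (EFin \o y).
    by apply/measurable_EFinP; exact: measurable_funTS.
  have y0E x : 0 <= (y x)%:E by rewrite lee_fin.
  have iG n : \int[mu]_(x in G n) (y x)%:E = (1 / (2 ^ n.+1)%:R)%:E.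
    rewrite (eq_integral (cst (c n)%:E)); last first.
      by move=> x; rewrite in_setE => /yG ->.
    rewrite integral_cst// -(fineK (Gfin n)) -EFinM divfK//.
    by rewrite gt_eqF// (lt_le_trans _ (fG2 n)).
  have iy t : \int[mu]_(s in `]-oo, t[) `|(y s)%:E| < +oo.
    rewrite (_ : \int[mu]_(s in _) _ = \int[mu]_(s in `]-oo, t[) (y s)%:E); last first.
      by apply: eq_integral => x _; rewrite gee0_abs.
    apply: (@le_lt_trans _ _ 1); last exact: ltry.
    apply: (@le_trans _ _ (\int[mu]_x (y x)%:E)).
      exact: (ge0_subset_integral _ (mitv _) measurableT (my' _) (fun x _ => y0E x)).
    have -> : \int[mu]_x (y x)%:E = \int[mu]_(x in \bigcup_n G n) (y x)%:E.
      rewrite [RHS]integral_mkcond; apply: eq_integral => x _; rewrite /patch.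
      case: ifPn => // /negP; rewrite in_setE => nGx; congr EFin; exact: y0.
    rewrite (ge0_integral_bigcup mu mG (my' _) (fun x _ => y0E x) tG).
    under eq_eseriesr do rewrite iG.
    exact: epsilon_trick0.
  have : {ae mu, forall t, (y t <= 0)%R}.
    (* The inequality holds everywhere: on [G n] the value [c n] is at most [2^-(n+2)] because
       [mu (G n) >= 2], and off the pieces [y] is 0. *)
    apply: HI => //; apply: aeW => t.
    have [[n _ Gt]|/y0 ->] := pselect ((\bigcup_n G n) t); last first.
      exact: integral_ge0.
    apply: (@le_trans _ _ (\int[mu]_(x in G n.+1) (y x)%:E)).
      rewrite iG (yG _ _ Gt) lee_fin /c (expnSr _ n.+1) natrM invfM mulrA.
      rewrite ler_wpM2l ?divr_ge0// lef_pV2 ?posrE//.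
      by rewrite (lt_le_trans _ (fG2 n)).
    apply: (ge0_subset_integral _ (mG _) (mitv _) (my' _) (fun x _ => y0E x)).
    move=> x /Gs /=; rewrite !in_itv /= => /andP[_ xs]; apply: lt_le_trans xs _.
    by move: Gt => /Gs /=; rewrite in_itv /= => /andP[].
  (* Since [y > 0] on [G 0], this set would be null, against its measure of at least 2. *)
  move=> /(@negligibleS _ _ _ _ _ (G 0%N)) nG; have G0 : mu (G 0%N) = 0.
    apply/negligibleP => //; apply: nG => x /yG /= ->; apply/negP; rewrite -ltNge.
    exact: c0.
  by have := G2 0%N; rewrite G0 lee_fin leNgt ltr0n.
Qed.
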